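(* Let $\mathcal{C}$ be a modular tensor category with braiding $\sigma$, and let $g,h$ be invertible objects of $\mathcal{C}$, of orders $|g|$ and $|h|$, such that $\sigma_{h,g}\circ\sigma_{g,h}=\mathrm{id}_{g\otimes h}$. Let $q_g,q_h$ be defined by $\sigma_{g,g}=q_g\,\mathrm{id}_{g\otimes g}$ and $\sigma_{h,h}=q_h\,\mathrm{id}_{h\otimes h}$, put $A_g:=|g|/|q_g^2|$ and $A_h:=|h|/|q_h^2|$ (where $|q^2|$ is the multiplicative order of $q^2$), assume $A_g+1$ is coprime to $|g|$ and $A_h+1$ is coprime to $|h|$, and fix primitive roots of unity $\zeta_{|g|}$, $\zeta_{|h|}$ of orders $|g|$, $|h|$ with $\zeta_{|g|}^{A_g}=q_g^2$ and $\zeta_{|h|}^{A_h}=q_h^2$. Then $$\mathcal{F}_{(g,\zeta_{|g|})}\circ\mathcal{F}_{(h,\zeta_{|h|})}\cong\mathcal{F}_{(h,\zeta_{|h|})}\circ\mathcal{F}_{(g,\zeta_{|g|})}$$ as monoidal auto-equivalences of $\mathcal{C}$, where $\mathcal{F}_{(g,\zeta_{|g|})}$ and $\mathcal{F}_{(h,\zeta_{|h|})}$ are the simple current auto-equivalences defined in the context.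
   Context: All categories are over $\mathbb{C}$; associators of $\mathcal{C}$ are suppressed. A modular tensor category is a pivotal braided fusion category whose symmetric centre $\{X:\sigma_{X,Y}\circ\sigma_{Y,X}=\mathrm{id}\text{ for all }Y\}$ is trivial. **Simple current auto-equivalences.** Let $g$ be an invertible object of order $M$ (minimal $M\ge1$ with $g^{\otimes M}\cong\mathbf 1$). Then $\sigma_{g,g}=q\,\mathrm{id}_{g\otimes g}$ for a scalar $q$ with $q^2$ an $M$-th root of unity. Put $A:=M/|q^2|$, assume $A+1$ is coprime to $M$ (which implies $q^M=1$), and fix a primitive $M$-th root of unity $\zeta_M$ with $\zeta_M^A=q^2$. For $m\in\mathbb{Z}/M\mathbb{Z}$ let $\mathcal{C}_m$ be the full abelian subcategory of objects $X$ for which the double braiding $\sigma_{g,X}\circ\sigma_{X,g}$ equals $\zeta_M^m$ times the identity; then $\mathcal{C}=\bigoplus_{m}\mathcal{C}_m$ is a $\mathbb{Z}/M\mathbb{Z}$-grading. Represent classes by $0,\dots,M-1$ and put $g^m:=g^{\otimes m}$. Define $\mathcal{F}_{(g,\zeta_M)}(X_m):=g^m\otimes X_m$ for $X_m\in\mathcal{C}_m$ (and $f\mapsto\mathrm{id}_{g^m}\otimes f$ on morphisms of $\mathcal{C}_m$), extended additively. Choose basis elements $v_{m,n}$ of $\mathrm{Hom}(g^m\otimes g^n,g^{m+n})$ (indices mod $M$) with $$v_{m+n,p}\circ(v_{m,n}\otimes\mathrm{id}_{g^p})=v_{m,n+p}\circ(\mathrm{id}_{g^m}\otimes v_{n,p}),\qquad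 v_{n,m}\circ\sigma_{g^m,g^n}=q^{mn}v_{m,n}$$ for all $m,n,p$ (this is possible). With the structure maps $$\tau_{X_m,Y_n}:=(v_{m,n}\otimes\mathrm{id}_{X_m\otimes Y_n})\circ(\mathrm{id}_{g^m}\otimes\sigma_{X_m,g^n}\otimes\mathrm{id}_{Y_n}):\mathcal{F}_{(g,\zeta_M)}(X_m)\otimes\mathcal{F}_{(g,\zeta_M)}(Y_n)\to\mathcal{F}_{(g,\zeta_M)}(X_m\otimes Y_n),$$ $\mathcal{F}_{(g,\zeta_M)}$ is a monoidal auto-equivalence of $\mathcal{C}$. Composites of monoidal functors carry the composite monoidal structure, and $\cong$ means existence of a monoidal natural isomorphism. *)

(* Defs.v *)
From HB Require Import structures.
From mathcomp Require Import all_boot all_order all_algebra.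
From mathcomp Require Import reals.
From mathcomp Require Export complex.

Set Implicit Arguments.
Unset Strict Implicit.
Unset Printing Implicit Defensive.

Import GRing.Theory.
Local Open Scope ring_scope.

Declare Scope cat_scope.
Delimit Scope cat_scope with cat.
Local Open Scope cat_scope.

(** * Linear categories with finite-dimensional morphism spaces *)

Record linear_category (R : realType) := LinearCategory {
  ob :> Type;
  hom : ob -> ob -> vectType R[i];
  idm : forall X, hom X X;
  comp : forall X Y Z, hom Y Z -> hom X Y -> hom X Z;
  comp_idl : forall X Y (f : hom X Y), comp (idm Y) f = f;
  comp_idr : forall X Y (f : hom X Y), comp f (idm X) = f;
  compA : forall X Y Z W (f : hom Z W) (g : hom Y Z) (h : hom X Y),
    comp f (comp g h) = comp (comp f g) h;
  comp_linl : forall X Y Z (a : R[i]) (f f' : hom Y Z) (g : hom X Y),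
    comp (a *: f + f') g = a *: comp f g + comp f' g;
  comp_linr : forall X Y Z (a : R[i]) (f : hom Y Z) (g g' : hom X Y),
    comp f (a *: g + g') = a *: comp f g + comp f g'
}.

Arguments hom {R l} X Y.
Arguments idm {R l} X.
Arguments comp {R l X Y Z} f g.

Notation "f ∘ g" := (comp f g) (at level 40, left associativity) : cat_scope.

Section Linear.
Context {R : realType} {C : linear_category R}.
Implicit Types X Y Z : C.

Definition inverses X Y (f : hom X Y) (f' : hom Y X) : Prop :=
  f' ∘ f = idm X /\ f ∘ f' = idm Y.

Definition is_iso X Y (f : hom X Y) : Prop := exists f', inverses f f'.

Definition isomorphic X Y : Prop := exists f : hom X Y, is_iso f.

Definition is_zero X : Prop := idm X = 0.

Definition mono X Y (f : hom X Y) : Prop :=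
  forall Z (u v : hom Z X), f ∘ u = f ∘ v -> u = v.

Definition epi X Y (f : hom X Y) : Prop :=
  forall Z (u v : hom Y Z), u ∘ f = v ∘ f -> u = v.

Definition is_kernel X Y (f : hom X Y) K (k : hom K X) : Prop :=
  f ∘ k = 0 /\
  forall Z (u : hom Z X), f ∘ u = 0 -> exists! w : hom Z K, k ∘ w = u.

Definition is_cokernel X Y (f : hom X Y) Q (p : hom Y Q) : Prop :=
  p ∘ f = 0 /\
  forall Z (u : hom Y Z), u ∘ f = 0 -> exists! w : hom Q Z, w ∘ p = u.

Definition simple X : Prop :=
  ~ is_zero X /\
  forall Y (u : hom Y X), mono u -> is_zero Y \/ is_iso u.

(** [X] is the direct sum (biproduct) of the finite family [Y]; for [n = 0]
    this says that [X] is a zero object. *)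
Record direct_sum n (Y : 'I_n -> C) X := DirectSum {
  inj : forall i, hom (Y i) X;
  prj : forall i, hom X (Y i);
  prj_inj : forall i, prj i ∘ inj i = idm (Y i);
  prj_inj0 : forall i j, i != j -> prj i ∘ inj j = 0;
  sum_inj_prj : \sum_(i < n) inj i ∘ prj i = idm X
}.

End Linear.

Arguments inj {R C n Y X} d i.
Arguments prj {R C n Y X} d i.

(** Finite direct sums are chosen once and for all, so that the additive
    extension of a functor is an honest construction. *)
Record abelian_structure R (C : linear_category R) := AbelianStructure {
  bigsum : forall n, ('I_n -> C) -> C;
  bigsumP : forall n (Y : 'I_n -> C), direct_sum Y (bigsum Y);
  has_kernels : forall (X Y : C) (f : hom X Y),
    exists K (k : hom K X), is_kernel f k;
  has_cokernels : forall (X Y : C) (f : hom X Y),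
    exists Q (p : hom Y Q), is_cokernel f p;
  mono_normal : forall (X Y : C) (f : hom X Y), mono f ->
    exists Z (u : hom Y Z), is_kernel u f;
  epi_normal : forall (X Y : C) (f : hom X Y), epi f ->
    exists Z (u : hom Z X), is_cokernel u f
}.

Definition semisimple R (C : linear_category R) : Prop :=
  forall X : C, exists n (S : 'I_n -> C),
    (forall i, simple (S i)) /\ inhabited (direct_sum S X).

Definition finitely_many_simples R (C : linear_category R) : Prop :=
  exists n (S : 'I_n -> C), forall X : C, simple X -> exists i, isomorphic X (S i).

(** * Monoidal categories *)

Record monoidal_category R := MonoidalCategory {
  mon_cat :> linear_category R;
  unit_ob : mon_cat;
  tens : mon_cat -> mon_cat -> mon_cat;
  tensm : forall X X' Y Y' : mon_cat,
    hom X X' -> hom Y Y' -> hom (tens X Y) (tens X' Y');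
  tensm_id : forall X Y : mon_cat, tensm (idm X) (idm Y) = idm (tens X Y);
  tensm_comp : forall (X X' X'' Y Y' Y'' : mon_cat)
      (f' : hom X' X'') (f : hom X X') (g' : hom Y' Y'') (g : hom Y Y'),
    tensm (f' ∘ f) (g' ∘ g) = tensm f' g' ∘ tensm f g;
  tensm_linl : forall (X X' Y Y' : mon_cat) (a : R[i])
      (f f' : hom X X') (g : hom Y Y'),
    tensm (a *: f + f') g = a *: tensm f g + tensm f' g;
  tensm_linr : forall (X X' Y Y' : mon_cat) (a : R[i])
      (f : hom X X') (g g' : hom Y Y'),
    tensm f (a *: g + g') = a *: tensm f g + tensm f g';
  assoc : forall X Y Z, hom (tens (tens X Y) Z) (tens X (tens Y Z));
  assocV : forall X Y Z, hom (tens X (tens Y Z)) (tens (tens X Y) Z);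
  assocK : forall X Y Z, inverses (assoc X Y Z) (assocV X Y Z);
  lunit : forall X, hom (tens unit_ob X) X;
  lunitV : forall X, hom X (tens unit_ob X);
  lunitK : forall X, inverses (lunit X) (lunitV X);
  runit : forall X, hom (tens X unit_ob) X;
  runitV : forall X, hom X (tens X unit_ob);
  runitK : forall X, inverses (runit X) (runitV X);
  assoc_nat : forall (X X' Y Y' Z Z' : mon_cat)
      (f : hom X X') (g : hom Y Y') (h : hom Z Z'),
    assoc X' Y' Z' ∘ tensm (tensm f g) h = tensm f (tensm g h) ∘ assoc X Y Z;
  lunit_nat : forall (X X' : mon_cat) (f : hom X X'),
    lunit X' ∘ tensm (idm unit_ob) f = f ∘ lunit X;
  runit_nat : forall (X X' : mon_cat) (f : hom X X'),
    runit X' ∘ tensm f (idm unit_ob) = f ∘ runit X;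
  pentagon : forall W X Y Z,
    assoc W X (tens Y Z) ∘ assoc (tens W X) Y Z =
    tensm (idm W) (assoc X Y Z) ∘ assoc W (tens X Y) Z
      ∘ tensm (assoc W X Y) (idm Z);
  triangle : forall X Y,
    tensm (idm X) (lunit Y) ∘ assoc X unit_ob Y = tensm (runit X) (idm Y)
}.

Arguments unit_ob {R m}.
Arguments tens {R m} X Y.
Arguments tensm {R m X X' Y Y'} f g.
Arguments assoc {R m} X Y Z.
Arguments assocV {R m} X Y Z.
Arguments lunit {R m} X.
Arguments lunitV {R m} X.
Arguments runit {R m} X.
Arguments runitV {R m} X.

Notation "𝟙" := unit_ob : cat_scope.
Notation "X ⊗ Y" := (tens X Y) (at level 35, right associativity) : cat_scope.
Notation "f ⊠ g" := (tensm f g) (at level 35, right associativity) : cat_scope.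

(** * Duality and pivotal structures *)

Section Duality.
Context {R : realType} {C : monoidal_category R}.
Implicit Types X Y Z D : C.

(** [D] is a left dual of [X], equivalently [X] is a right dual of [D]. *)
Record duality D X := Duality {
  ev : hom (D ⊗ X) 𝟙;
  coev : hom 𝟙 (X ⊗ D);
  zigzag_l : runit X ∘ (idm X ⊠ ev) ∘ assoc X D X ∘ (coev ⊠ idm X) ∘ lunitV X
             = idm X;
  zigzag_r : lunit D ∘ (ev ⊠ idm D) ∘ assocV D X D ∘ (idm D ⊠ coev) ∘ runitV D
             = idm D
}.

(** The morphism [Z -> D] corresponding to a pairing [e : Z ⊗ X -> 𝟙]. *)
Definition mate D X (d : duality D X) Z (e : hom (Z ⊗ X) 𝟙) : hom Z D :=
  lunit D ∘ (e ⊠ idm D) ∘ assocV Z X D ∘ (idm Z ⊠ coev d) ∘ runitV Z.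

Variables (dual : C -> C) (dualP : forall X, duality (dual X) X).

Definition dualm X Y (f : hom X Y) : hom (dual Y) (dual X) :=
  mate (dualP X) (ev (dualP Y) ∘ (idm (dual Y) ⊠ f)).

(** The canonical isomorphism [Y^* ⊗ X^* -> (X ⊗ Y)^*]. *)
Definition dual_tens X Y : hom (dual Y ⊗ dual X) (dual (X ⊗ Y)) :=
  mate (dualP (X ⊗ Y))
    (ev (dualP Y)
       ∘ (idm (dual Y) ⊠ (lunit Y ∘ (ev (dualP X) ⊠ idm Y) ∘ assocV (dual X) X Y))
       ∘ assoc (dual Y) (dual X) (X ⊗ Y)).

(** [piv] is a monoidal natural isomorphism from the identity functor to the
    double dual functor.  The monoidal structure
    [X^** ⊗ Y^** -> (X ⊗ Y)^**] of the latter is the composite of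
    [dual_tens Y^* X^*] with the inverse of [dualm (dual_tens X Y)]; the last
    clause has that inverse moved to the other side.  Compatibility with the
    unit isomorphisms is automatic for isomorphisms compatible with [⊗]. *)
Definition pivotal_axioms (piv : forall X, hom X (dual (dual X))) : Prop :=
  [/\ forall X, is_iso (piv X),
      forall X Y (f : hom X Y), piv Y ∘ f = dualm (dualm f) ∘ piv X
    & forall X Y, dualm (dual_tens X Y) ∘ piv (X ⊗ Y)
                  = dual_tens (dual Y) (dual X) ∘ (piv X ⊠ piv Y)].

End Duality.

(** * Modular tensor categories *)

Record pivotal_fusion_category R := PivotalFusionCategory {
  fus_cat :> monoidal_category R;
  fus_abelian : abelian_structure fus_cat;
  fus_semisimple : semisimple fus_cat;
  fus_finite : finitely_many_simples fus_cat;
  fus_unit_simple : simple (unit_ob : fus_cat);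
  dual : fus_cat -> fus_cat;
  dualP : forall X, duality (dual X) X;
  has_right_dual : forall X : fus_cat, exists D, inhabited (duality X D);
  piv : forall X, hom X (dual (dual X));
  pivP : pivotal_axioms dualP piv
}.

Record modular_tensor_category R := ModularTensorCategory {
  mod_cat :> pivotal_fusion_category R;
  braid : forall X Y : mod_cat, hom (X ⊗ Y) (Y ⊗ X);
  braid_iso : forall X Y, is_iso (braid X Y);
  braid_nat : forall (X X' Y Y' : mod_cat) (f : hom X X') (g : hom Y Y'),
    braid X' Y' ∘ (f ⊠ g) = (g ⊠ f) ∘ braid X Y;
  hexagon1 : forall X Y Z,
    assoc Y Z X ∘ braid X (Y ⊗ Z) ∘ assoc X Y Z =
    (idm Y ⊠ braid X Z) ∘ assoc Y X Z ∘ (braid X Y ⊠ idm Z);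
  hexagon2 : forall X Y Z,
    assocV Z X Y ∘ braid (X ⊗ Y) Z ∘ assocV X Y Z =
    (braid X Z ⊠ idm Y) ∘ assocV X Z Y ∘ (idm X ⊠ braid Y Z);
  trivial_centre : forall X,
    (forall Y, braid Y X ∘ braid X Y = idm (X ⊗ Y)) ->
    exists n, inhabited (direct_sum (fun _ : 'I_n => 𝟙) X)
}.

Arguments braid {R m} X Y.

(** * Monoidal functors *)

(** Object map, morphism map and structure maps [F X ⊗ F Y -> F (X ⊗ Y)] of a
    monoidal endofunctor.  These are all that composites of monoidal functors
    and monoidal natural isomorphisms depend on.  The unit isomorphism
    [𝟙 -> F 𝟙] is determined by the structure maps, and natural isomorphisms
    compatible with the latter are automatically compatible with it. *)
Record monoidal_functor_data R (C : monoidal_category R) := MonoidalFunctorData {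
  fob :> C -> C;
  fmap : forall X Y : C, hom X Y -> hom (fob X) (fob Y);
  fstr : forall X Y : C, hom (fob X ⊗ fob Y) (fob (X ⊗ Y))
}.

Arguments fmap {R C} m {X Y} f.
Arguments fstr {R C} m X Y.

Definition mcomp R (C : monoidal_category R) (F G : monoidal_functor_data C) :
    monoidal_functor_data C :=
  {| fob := fun X => F (G X);
     fmap := fun X Y f => fmap F (fmap G f);
     fstr := fun X Y => fmap F (fstr G X Y) ∘ fstr F (G X) (G Y) |}.

Definition monoidal_isomorphic R (C : monoidal_category R)
    (F G : monoidal_functor_data C) : Prop :=
  exists eta : forall X, hom (F X) (G X),
    [/\ forall X, is_iso (eta X),
        forall X Y (f : hom X Y), eta Y ∘ fmap F f = fmap G f ∘ eta X
      & forall X Y, eta (X ⊗ Y) ∘ fstr F X Y = fstr G X Y ∘ (eta X ⊠ eta Y)].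

(** * Simple current auto-equivalences *)

Section SimpleCurrent.
Context {R : realType} {C : modular_tensor_category R}.
Implicit Types X Y g : C.

Definition invertible g : Prop :=
  exists g' : C, isomorphic (g ⊗ g') 𝟙 /\ isomorphic (g' ⊗ g) 𝟙.

Fixpoint tpow g (m : nat) : C :=
  if m is m'.+1 then g ⊗ tpow g m' else 𝟙.

Definition has_order g (M : nat) : Prop :=
  [/\ (0 < M)%N, isomorphic (tpow g M) 𝟙
    & forall k, (0 < k)%N -> isomorphic (tpow g k) 𝟙 -> (M <= k)%N].

(** [X] lies in the component [C_m] of the grading defined by [(g, zeta)]. *)
Definition in_degree g (zeta : R[i]) (m : nat) X : Prop :=
  braid g X ∘ braid X g = zeta ^+ m *: idm (X ⊗ g).

(** A choice, for every object, of its homogeneous components. *)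
Record homogeneous_decomposition g (M : nat) (zeta : R[i]) :=
  HomogeneousDecomposition {
    component : C -> 'I_M -> C;
    componentP : forall X (m : 'I_M), in_degree g zeta m (component X m);
    decomposition : forall X, direct_sum (component X) X
  }.

(** Basis elements [v m n k] of [Hom (g^m ⊗ g^n, g^k)], where [k] represents
    [m + n] modulo [M].  Carrying [k] along avoids transports between equal
    powers of [g]; the values for other [k] are irrelevant and unused. *)
Record power_basis g (M : nat) (q : R[i]) := PowerBasis {
  pb : forall m n k : 'I_M, hom (tpow g m ⊗ tpow g n) (tpow g k);
  pb_basis : forall m n k : 'I_M, k = m + n %[mod M] ->
    basis_of fullv [:: pb m n k];
  pb_assoc : forall m n p a b s : 'I_M,
    a = m + n %[mod M] -> b = n + p %[mod M] -> s = m + n + p %[mod M] ->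
    pb a p s ∘ (pb m n a ⊠ idm (tpow g p)) =
    pb m b s ∘ (idm (tpow g m) ⊠ pb n p b)
      ∘ assoc (tpow g m) (tpow g n) (tpow g p);
  pb_braid : forall m n k : 'I_M, k = m + n %[mod M] ->
    pb n m k ∘ braid (tpow g m) (tpow g n) = q ^+ (m * n) *: pb m n k
}.

Variables (g : C) (M : nat) (zeta q : R[i]).
Variables (D : homogeneous_decomposition g M zeta) (v : power_basis g M q).

(** [τ_{X,Y}] for [X] of degree [m], [Y] of degree [n], and [k = m + n] mod [M],
    with the associators made explicit. *)
Definition sc_tau (m n k : 'I_M) X Y :
    hom ((tpow g m ⊗ X) ⊗ (tpow g n ⊗ Y)) (tpow g k ⊗ (X ⊗ Y)) :=
  (pb v m n k ⊠ idm (X ⊗ Y))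
    ∘ assocV (tpow g m) (tpow g n) (X ⊗ Y)
    ∘ (idm (tpow g m) ⊠
         (assoc (tpow g n) X Y ∘ (braid X (tpow g n) ⊠ idm Y)
            ∘ assocV X (tpow g n) Y))
    ∘ assoc (tpow g m) X (tpow g n ⊗ Y).

Definition sc_summand X (m : 'I_M) : C := tpow g m ⊗ component D X m.

Definition sc_ob X : C := bigsum (fus_abelian C) (sc_summand X).

Definition sc_sum X : direct_sum (sc_summand X) (sc_ob X) :=
  bigsumP (fus_abelian C) (sc_summand X).

Definition sc_map X Y (f : hom X Y) : hom (sc_ob X) (sc_ob Y) :=
  \sum_(m < M)
    inj (sc_sum Y) m
      ∘ (idm (tpow g m) ⊠
           (prj (decomposition D Y) m ∘ f ∘ inj (decomposition D X) m))
      ∘ prj (sc_sum X) m.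

(** On the summands indexed by [m] and [n], this is [sc_tau] followed by the
    image of the inclusion [X_m ⊗ Y_n -> X ⊗ Y]. *)
Definition sc_str X Y : hom (sc_ob X ⊗ sc_ob Y) (sc_ob (X ⊗ Y)) :=
  \sum_(m < M) \sum_(n < M) \sum_(k < M | k == m + n %[mod M])
    inj (sc_sum (X ⊗ Y)) k
      ∘ (idm (tpow g k) ⊠
           (prj (decomposition D (X ⊗ Y)) k
              ∘ (inj (decomposition D X) m ⊠ inj (decomposition D Y) n)))
      ∘ sc_tau m n k (component D X m) (component D Y n)
      ∘ (prj (sc_sum X) m ⊠ prj (sc_sum Y) n).

Definition simple_current : monoidal_functor_data C :=
  {| fob := sc_ob; fmap := sc_map; fstr := sc_str |}.

End SimpleCurrent.

(* Main.v *)
Require Import Defs.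
From mathcomp Require Import all_boot all_order all_algebra.
From mathcomp Require Import reals.
Import Defs.

(** Up to isomorphism, [X] is the direct sum of pieces [X_(m,n)] that have
    degree [m] for [g] and degree [n] for [h].  Because [g] and [h] have trivial
    monodromy, tensoring with a power of [h] does not change the degree for [g],
    so the composite of [F_g] after [F_h] sends [X] to the sum of the
    [g^m ⊗ (h^n ⊗ X_(m,n))], and the composite in the other order to the sum of
    the [h^n ⊗ (g^m ⊗ X_(m,n))].  The isomorphism is the braiding of [g^m] with
    [h^n] on each summand ([exchange]).

    It is monoidal for a topological reason.  The two structure maps carry
    [(g^m h^n X) (g^m' h^n' Y)] to [(g^m g^m') (h^n h^n') X Y] and to
    [(h^n h^n') (g^m g^m') X Y]; in both, [X] is braided past [g^m'] and [h^n'],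
    and powers of [g] cross powers of [h].  A crossing of the latter kind may be
    replaced by its inverse, the monodromy being trivial, and the remaining
    discrepancy is a Yang-Baxter move of [X] across [g^m'] and [h^n'].  This is
    [swap_interchange]; the multiplications of powers are slid along the strands
    by naturality.

    To calculate with braids despite the associators, [swap_interchange] is
    transported along the Cayley embedding [X |-> X ⊗ -] of the category in its
    endofunctors, where the associator becomes the identity ([hat]).

    The chosen homogeneous components [X_m] enter only through the projectors
    [homog_proj] of [X] onto them.  These are natural, since there are no
    nonzero morphisms between different degrees ([hom_in_degree_neq]), and
    [F_g X] is presented as a retract of the sum of the [g^m ⊗ X], through
    [to_summand] and [of_summand].  The maps [of_summand] are jointly epic, and
    in terms of them the functor acts by whiskering and its structure maps are
    given by [interchange] ([of_summand_nat], [sc_str_of_summand]). *)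

Set Implicit Arguments.
Unset Strict Implicit.
Unset Printing Implicit Defensive.

Import GRing.Theory.
Local Open Scope ring_scope.
Local Open Scope cat_scope.

(** * Linearity of composition and tensor product *)

Section LinearMaps.
Context (K : pzRingType) (U V : lmodType K) (f : U -> V).
Hypothesis f_linear : forall a x y, f (a *: x + y) = a *: f x + f y.

Lemma linear_map0 : f 0 = 0.
Proof.
have := f_linear 1 0 0; rewrite !scale1r addr0 => /eqP.
by rewrite -subr_eq subrr eq_sym => /eqP.
Qed.

Lemma linear_mapZ a x : f (a *: x) = a *: f x.
Proof. by have := f_linear a x 0; rewrite linear_map0 !addr0. Qed.

Lemma linear_map_sum I r (P : pred I) F :
  f (\sum_(i <- r | P i) F i) = \sum_(i <- r | P i) f (F i).
Proof.
apply: (big_morph f _ linear_map0) => x y.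
by have := f_linear 1 x y; rewrite !scale1r.
Qed.
End LinearMaps.

Section LinearCategory.
Context {R : realType} {C : linear_category R}.
Implicit Types X Y Z W : C.

Lemma comp0l X Y Z (g : hom X Y) : (0 : hom Y Z) ∘ g = 0.
Proof. exact: (linear_map0 (fun a f f' => comp_linl a f f' g)). Qed.
Lemma comp0r X Y Z (f : hom Y Z) : f ∘ (0 : hom X Y) = 0.
Proof. exact: (linear_map0 (fun a g g' => comp_linr a f g g')). Qed.
Lemma compZl X Y Z a (f : hom Y Z) (g : hom X Y) : (a *: f) ∘ g = a *: (f ∘ g).
Proof. exact: (linear_mapZ (fun a f f' => comp_linl a f f' g)). Qed.
Lemma compZr X Y Z a (f : hom Y Z) (g : hom X Y) : f ∘ (a *: g) = a *: (f ∘ g).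
Proof. exact: (linear_mapZ (fun a g g' => comp_linr a f g g')). Qed.
Lemma comp_suml X Y Z I r (P : pred I) (F : I -> hom Y Z) (g : hom X Y) :
  (\sum_(i <- r | P i) F i) ∘ g = \sum_(i <- r | P i) F i ∘ g.
Proof. exact: (linear_map_sum (fun a f f' => comp_linl a f f' g)). Qed.
Lemma comp_sumr X Y Z I r (P : pred I) (f : hom Y Z) (F : I -> hom X Y) :
  f ∘ (\sum_(i <- r | P i) F i) = \sum_(i <- r | P i) f ∘ F i.
Proof. exact: (linear_map_sum (fun a g g' => comp_linr a f g g')). Qed.

(** Lets an equation [f ∘ g = k] be used inside a composite associated to the
    right. *)
Lemma reassoc X Y Z (f : hom Y Z) (g : hom X Y) k :
  f ∘ g = k -> forall W (u : hom W X), f ∘ (g ∘ u) = k ∘ u.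
Proof. by move=> <- W u; rewrite compA. Qed.

Lemma iso_mono X Y (f : hom X Y) : is_iso f -> mono f.
Proof.
case=> f' [f'f _] Z u v /(congr1 (comp f')).
by rewrite !compA f'f !comp_idl.
Qed.

Lemma iso_epi X Y (f : hom X Y) : is_iso f -> epi f.
Proof.
case=> f' [_ ff'] Z u v /(congr1 (fun w => w ∘ f')).
by rewrite -!compA ff' !comp_idr.
Qed.
End LinearCategory.

Section MonoidalCategory.
Context {R : realType} {C : monoidal_category R}.
Implicit Types X Y Z W : C.

Lemma tensm0l X X' Y Y' (g : hom Y Y') : (0 : hom X X') ⊠ g = 0.
Proof. exact: (linear_map0 (fun a f f' => tensm_linl a f f' g)). Qed.
Lemma tensm0r X X' Y Y' (f : hom X X') : f ⊠ (0 : hom Y Y') = 0.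
Proof. exact: (linear_map0 (fun a g g' => tensm_linr a f g g')). Qed.
Lemma tensmZl X X' Y Y' a (f : hom X X') (g : hom Y Y') :
  (a *: f) ⊠ g = a *: (f ⊠ g).
Proof. exact: (linear_mapZ (fun a f f' => tensm_linl a f f' g)). Qed.
Lemma tensmZr X X' Y Y' a (f : hom X X') (g : hom Y Y') :
  f ⊠ (a *: g) = a *: (f ⊠ g).
Proof. exact: (linear_mapZ (fun a g g' => tensm_linr a f g g')). Qed.
Lemma tensm_suml X X' Y Y' I r (P : pred I) (F : I -> hom X X') (g : hom Y Y') :
  (\sum_(i <- r | P i) F i) ⊠ g = \sum_(i <- r | P i) F i ⊠ g.
Proof. exact: (linear_map_sum (fun a f f' => tensm_linl a f f' g)). Qed.
Lemma tensm_sumr X X' Y Y' I r (P : pred I) (f : hom X X') (F : I -> hom Y Y') :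
  f ⊠ (\sum_(i <- r | P i) F i) = \sum_(i <- r | P i) f ⊠ F i.
Proof. exact: (linear_map_sum (fun a g g' => tensm_linr a f g g')). Qed.

Lemma whiskl_comp W X Y Z (f : hom Y Z) (g : hom X Y) :
  (idm W ⊠ f) ∘ (idm W ⊠ g) = idm W ⊠ (f ∘ g).
Proof. by rewrite -tensm_comp comp_idl. Qed.
Lemma whiskr_comp W X Y Z (f : hom Y Z) (g : hom X Y) :
  (f ⊠ idm W) ∘ (g ⊠ idm W) = (f ∘ g) ⊠ idm W.
Proof. by rewrite -tensm_comp comp_idl. Qed.
Lemma whisk_lr X X' Y Y' (f : hom X X') (g : hom Y Y') :
  (idm X' ⊠ g) ∘ (f ⊠ idm Y) = f ⊠ g.
Proof. by rewrite -tensm_comp comp_idl comp_idr. Qed.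
Lemma whisk_rl X X' Y Y' (f : hom X X') (g : hom Y Y') :
  (f ⊠ idm Y') ∘ (idm X ⊠ g) = f ⊠ g.
Proof. by rewrite -tensm_comp comp_idl comp_idr. Qed.

Lemma assocVK X Y Z : assocV X Y Z ∘ assoc X Y Z = idm _.
Proof. by case: (assocK X Y Z). Qed.
Lemma assocKV X Y Z : assoc X Y Z ∘ assocV X Y Z = idm _.
Proof. by case: (assocK X Y Z). Qed.

Lemma iso_assoc X Y Z : is_iso (assoc X Y Z).
Proof. by exists (assocV X Y Z); apply: assocK. Qed.
Lemma iso_lunit X : is_iso (lunit X).
Proof. by exists (lunitV X); apply: lunitK. Qed.
Lemma iso_runit X : is_iso (runit X).
Proof. by exists (runitV X); apply: runitK. Qed.

Lemma iso_tensm X X' Y Y' (f : hom X X') (g : hom Y Y') :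
  is_iso f -> is_iso g -> is_iso (f ⊠ g).
Proof.
case=> f' [f'f ff'] [g' [g'g gg']]; exists (f' ⊠ g').
by split; rewrite -tensm_comp ?f'f ?g'g ?ff' ?gg' tensm_id.
Qed.

Lemma iso_idm X : is_iso (idm X).
Proof. by exists (idm X); split; rewrite comp_idl. Qed.

Lemma assocV_nat X X' Y Y' Z Z' (f : hom X X') (g : hom Y Y') (h : hom Z Z') :
  assocV X' Y' Z' ∘ (f ⊠ g ⊠ h) = ((f ⊠ g) ⊠ h) ∘ assocV X Y Z.
Proof.
apply: (iso_mono (iso_assoc X' Y' Z')).
by rewrite !compA assocKV assoc_nat -compA assocKV comp_idl comp_idr.
Qed.

Lemma whiskr_unit_inj X Y (f g : hom X Y) :
  f ⊠ idm 𝟙 = g ⊠ idm 𝟙 -> f = g.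
Proof.
move=> /(congr1 (comp (runit Y))); rewrite !runit_nat.
exact: (iso_epi (iso_runit X)).
Qed.

Lemma whiskl_unit_inj X Y (f g : hom X Y) :
  idm 𝟙 ⊠ f = idm 𝟙 ⊠ g -> f = g.
Proof.
move=> /(congr1 (comp (lunit Y))); rewrite !lunit_nat.
exact: (iso_epi (iso_lunit X)).
Qed.

(** Kelly's argument: after tensoring with the unit on the left, which is
    faithful, the pentagon and two triangles give the claim. *)
Lemma lunit_tens X Y : lunit (X ⊗ Y) ∘ assoc 𝟙 X Y = lunit X ⊠ idm Y.
Proof.
apply: whiskl_unit_inj.
apply: (iso_epi (iso_assoc 𝟙 (𝟙 ⊗ X) Y)).
apply: (iso_epi (iso_tensm (iso_assoc 𝟙 𝟙 X) (iso_idm Y))).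
rewrite -whiskl_comp -!compA [idm 𝟙 ⊠ assoc _ _ _ ∘ _]compA.
rewrite -pentagon compA triangle -tensm_id -assoc_nat.
by rewrite -triangle -whiskr_comp compA assoc_nat -!compA.
Qed.

Lemma runit_tens X Y : (idm X ⊠ runit Y) ∘ assoc X Y 𝟙 = runit (X ⊗ Y).
Proof.
apply: whiskr_unit_inj.
apply: (iso_mono (iso_assoc X Y 𝟙)).
rewrite -whiskr_comp compA assoc_nat -[runit Y ⊠ _]triangle -whiskl_comp.
rewrite -[runit (X ⊗ Y) ⊠ _]triangle compA -tensm_id assoc_nat.
by rewrite -!compA; congr (_ ∘ _); rewrite pentagon -compA.
Qed.

End MonoidalCategory.

(** * Strictification by the Cayley embedding *)

Section Strict.
Context {R : realType} {C : monoidal_category R}.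
Implicit Types X Y Z W : C.

(** Bracketings are kept as syntax, so that the source and target of an
    associator have the same action [act] on objects by computation, and no
    transports are needed to say that it becomes the identity. *)
Inductive shape := Leaf of C | Node of shape & shape.

Fixpoint obj (s : shape) : C :=
  match s with Leaf X => X | Node s t => obj s ⊗ obj t end.

(** The image of a bracketed product under the Cayley embedding: the composite
    of the functors [X ⊗ -] of its leaves. *)
Fixpoint act (s : shape) Z : C :=
  match s with Leaf X => X ⊗ Z | Node s t => act s (act t Z) end.

Fixpoint actm (s : shape) Z Z' (u : hom Z Z') : hom (act s Z) (act s Z') :=
  match s with Leaf X => idm X ⊠ u | Node s t => actm s (actm t u) end.

(** The coherence isomorphism that makes the Cayley embedding monoidal. *)
Fixpoint can (s : shape) Z : hom (obj s ⊗ Z) (act s Z) :=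
  match s with
  | Leaf X => idm (X ⊗ Z)
  | Node s t => can s (act t Z) ∘ (idm (obj s) ⊠ can t Z) ∘ assoc (obj s) (obj t) Z
  end.

Fixpoint canV (s : shape) Z : hom (act s Z) (obj s ⊗ Z) :=
  match s with
  | Leaf X => idm (X ⊗ Z)
  | Node s t =>
      assocV (obj s) (obj t) Z ∘ (idm (obj s) ⊠ canV t Z) ∘ canV s (act t Z)
  end.

(** The natural transformation [act s -> act t] that corresponds to [f]. *)
Definition hat (s t : shape) (f : hom (obj s) (obj t)) Z : hom (act s Z) (act t Z) :=
  can t Z ∘ (f ⊠ idm Z) ∘ canV s Z.

Lemma canVK s Z : canV s Z ∘ can s Z = idm _.
Proof.
elim: s Z => [X|s IHs t IHt] Z /=; first by rewrite comp_idl.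
rewrite -!compA (reassoc (IHs _)) comp_idl (reassoc (whiskl_comp _ _ _)) IHt.
by rewrite tensm_id comp_idl assocVK.
Qed.

Lemma canKV s Z : can s Z ∘ canV s Z = idm _.
Proof.
elim: s Z => [X|s IHs t IHt] Z /=; first by rewrite comp_idl.
rewrite -!compA (reassoc (assocKV _ _ _)) comp_idl.
by rewrite (reassoc (whiskl_comp _ _ _)) IHt tensm_id comp_idl IHs.
Qed.

Lemma actm_id s Z : actm s (idm Z) = idm _.
Proof. by elim: s Z => [X|s IHs t IHt] Z /=; rewrite ?tensm_id ?IHt ?IHs. Qed.

Lemma actm_comp s Z Z' Z'' (u : hom Z' Z'') (v : hom Z Z') :
  actm s u ∘ actm s v = actm s (u ∘ v).
Proof.
elim: s Z Z' Z'' u v => [X|s IHs t IHt] Z Z' Z'' u v /=.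
  by rewrite whiskl_comp.
by rewrite IHs IHt.
Qed.

Lemma can_nat s Z Z' (u : hom Z Z') :
  can s Z' ∘ (idm (obj s) ⊠ u) = actm s u ∘ can s Z.
Proof.
elim: s Z Z' u => [X|s IHs t IHt] Z Z' u /=.
  by rewrite comp_idl comp_idr.
rewrite -tensm_id -compA assoc_nat !compA -IHs -!compA.
by rewrite !(reassoc (whiskl_comp _ _ _)) IHt.
Qed.

Lemma canV_nat s Z Z' (u : hom Z Z') :
  canV s Z' ∘ actm s u = (idm (obj s) ⊠ u) ∘ canV s Z.
Proof.
rewrite -[RHS]comp_idl -canVK -[RHS]compA (reassoc (can_nat _ _)).
by rewrite -!compA canKV comp_idr.
Qed.

(** Evaluating at the unit recovers [f]: the Cayley embedding is faithful. *)
Lemma hat_inj s t (f g : hom (obj s) (obj t)) :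
  (forall Z, hat f Z = hat g Z) -> f = g.
Proof.
move=> /(_ 𝟙) /(congr1 (fun w => canV t 𝟙 ∘ w ∘ can s 𝟙)).
rewrite /hat -!compA canVK !comp_idr !(reassoc (canVK _ _)) !comp_idl.
exact: whiskr_unit_inj.
Qed.

Lemma hat_id s Z : hat (idm (obj s)) Z = idm _.
Proof. by rewrite /hat tensm_id comp_idr canKV. Qed.

Lemma hatZ s t a (f : hom (obj s) (obj t)) Z : hat (a *: f) Z = a *: hat f Z.
Proof. by rewrite /hat tensmZl compZr compZl. Qed.

Lemma hat_comp s t w (f : hom (obj t) (obj w)) (g : hom (obj s) (obj t)) Z :
  hat (f ∘ g) Z = hat f Z ∘ hat g Z.
Proof.
by rewrite /hat -!compA (reassoc (canVK _ _)) comp_idl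
           (reassoc (whiskr_comp _ _ _)).
Qed.

Lemma hat_nat s t (f : hom (obj s) (obj t)) Z Z' (u : hom Z Z') :
  hat f Z' ∘ actm s u = actm t u ∘ hat f Z.
Proof.
rewrite /hat -!compA canV_nat (reassoc (whisk_rl _ _)) -whisk_lr.
by rewrite -compA (reassoc (can_nat _ _)) -compA.
Qed.

Lemma hat_tens s s' t t' (f : hom (obj s) (obj s')) (g : hom (obj t) (obj t')) Z :
  hat (s := Node s t) (t := Node s' t') (f ⊠ g) Z
  = hat f (act t' Z) ∘ actm s (hat g Z).
Proof.
rewrite /hat /= -!compA canV_nat (reassoc (assoc_nat _ _ _)) -!compA.
rewrite (reassoc (assocKV _ _ _)) comp_idl.
congr (_ ∘ _); rewrite !compA; congr (_ ∘ _).
by rewrite -!tensm_comp !comp_idl !comp_idr.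
Qed.

Lemma hat_whiskl s t t' (g : hom (obj t) (obj t')) Z :
  hat (s := Node s t) (t := Node s t') (idm (obj s) ⊠ g) Z = actm s (hat g Z).
Proof. by rewrite hat_tens hat_id comp_idl. Qed.

Lemma hat_whiskr s s' t (f : hom (obj s) (obj s')) Z :
  hat (s := Node s t) (t := Node s' t) (f ⊠ idm (obj t)) Z = hat f (act t Z).
Proof. by rewrite hat_tens hat_id actm_id comp_idr. Qed.

(** This is the pentagon. *)
Lemma hat_assoc s t w Z :
  hat (s := Node (Node s t) w) (t := Node s (Node t w))
    (assoc (obj s) (obj t) (obj w)) Z = idm _.
Proof.
rewrite -[RHS](canKV (Node (Node s t) w)) /hat; congr (_ ∘ _) => /=.
rewrite -!compA -[idm (obj s ⊗ obj t)]tensm_id (reassoc (assoc_nat _ _ _)).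
rewrite -!compA -!whiskl_comp -!compA.
by do 3!congr (_ ∘ _); rewrite compA -pentagon.
Qed.

Lemma hat_assocV s t w Z :
  hat (s := Node s (Node t w)) (t := Node (Node s t) w)
    (assocV (obj s) (obj t) (obj w)) Z = idm _.
Proof.
have := hat_comp (s := Node s (Node t w)) (t := Node (Node s t) w)
  (w := Node s (Node t w)) (assoc _ _ _) (assocV _ _ _) Z.
by rewrite hat_assoc comp_idl assocKV => <-; rewrite (hat_id (Node s (Node t w))).
Qed.

End Strict.

(** * Braids *)

Section Braided.
Context {R : realType} {C : modular_tensor_category R}.
Implicit Types (X Y Z W g : C) (s t w : @shape R C).

Definition monodromy X Y : hom (X ⊗ Y) (X ⊗ Y) := braid Y X ∘ braid X Y.

(** [swap], [interchange] and several composites below are sealed, so that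
    reassociating an expression does not break them up. *)
Definition swap X Y Z : hom (X ⊗ (Y ⊗ Z)) (Y ⊗ (X ⊗ Z)) :=
  locked (assoc Y X Z ∘ (braid X Y ⊠ idm Z) ∘ assocV X Y Z).

Lemma swapE X Y Z : swap X Y Z =
  assoc Y X Z ∘ (braid X Y ⊠ idm Z) ∘ assocV X Y Z.
Proof. by rewrite /swap -lock. Qed.

(** The tensor product functor is monoidal through this map, which also is the
    structure map of a simple current functor before the powers of the
    invertible object are multiplied ([sc_tauE]). *)
Definition interchange X Y Z W : hom ((X ⊗ Y) ⊗ (Z ⊗ W)) ((X ⊗ Z) ⊗ (Y ⊗ W)) :=
  locked (assocV X Z (Y ⊗ W) ∘ (idm X ⊠ swap Y Z W) ∘ assoc X Y (Z ⊗ W)).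

Lemma interchangeE X Y Z W : interchange X Y Z W =
  assocV X Z (Y ⊗ W) ∘ (idm X ⊠ swap Y Z W) ∘ assoc X Y (Z ⊗ W).
Proof. by rewrite /interchange -lock. Qed.

Definition hat_braid s t Z : hom (act s (act t Z)) (act t (act s Z)) :=
  locked (hat (s := Node s t) (t := Node t s) (braid (obj s) (obj t)) Z).

Lemma hat_braidE s t Z :
  hat_braid s t Z = hat (s := Node s t) (t := Node t s) (braid (obj s) (obj t)) Z.
Proof. by rewrite /hat_braid -lock. Qed.

Lemma hat_braid_nat s t Z Z' (u : hom Z Z') :
  hat_braid s t Z' ∘ actm s (actm t u) = actm t (actm s u) ∘ hat_braid s t Z.
Proof. by rewrite !hat_braidE; apply: (hat_nat (s := Node s t) (t := Node t s)). Qed.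

Lemma hat_braid_tensr s t w Z :
  hat_braid s (Node t w) Z = actm t (hat_braid s w Z) ∘ hat_braid s t (act w Z).
Proof.
rewrite !hat_braidE.
have /(congr1 (fun f => hat (s := Node (Node s t) w) (t := Node t (Node w s)) f Z))
  := hexagon1 (obj s) (obj t) (obj w).
rewrite (hat_comp (t := Node s (Node t w))) (hat_comp (t := Node (Node t w) s)).
rewrite !hat_assoc comp_idl comp_idr => e; apply: etrans e _.
rewrite (hat_comp (t := Node (Node t s) w)) (hat_comp (t := Node t (Node s w))).
by rewrite hat_assoc comp_idr (hat_whiskl _ (t := Node s w) (t' := Node w s))
           (hat_whiskr (s := Node s t) (s' := Node t s)).
Qed.

Lemma hat_braid_tensl s t w Z :
  hat_braid (Node s t) w Z = hat_braid s w (act t Z) ∘ actm s (hat_braid t w Z).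
Proof.
rewrite !hat_braidE.
have /(congr1 (fun f => hat (s := Node s (Node t w)) (t := Node (Node w s) t) f Z))
  := hexagon2 (obj s) (obj t) (obj w).
rewrite (hat_comp (t := Node (Node s t) w)) (hat_comp (t := Node w (Node s t))).
rewrite !hat_assocV comp_idl comp_idr => e; apply: etrans e _.
rewrite (hat_comp (t := Node s (Node w t))) (hat_comp (t := Node (Node s w) t)).
by rewrite hat_assocV comp_idr (hat_whiskl _ (t := Node t w) (t' := Node w t))
           (hat_whiskr (s := Node s w) (s' := Node w s)).
Qed.

(** Naturality of the braiding of [s] with [t ⊗ w], applied to the braiding of
    [t] with [w]; the hexagons split the braidings with a product. *)
Lemma yang_baxter s t w Z :
  actm w (hat_braid s t Z) ∘ hat_braid s w (act t Z) ∘ actm s (hat_braid t w Z)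
  = hat_braid t w (act s Z) ∘ actm t (hat_braid s w Z) ∘ hat_braid s t (act w Z).
Proof.
suff e : hat_braid s (Node w t) Z ∘ actm s (hat_braid t w Z)
       = hat_braid t w (act s Z) ∘ hat_braid s (Node t w) Z.
  by rewrite -hat_braid_tensr e hat_braid_tensr compA.
rewrite !hat_braidE.
have /(congr1 (fun f => hat (s := Node s (Node t w)) (t := Node (Node w t) s) f Z))
  := braid_nat (idm (obj s)) (braid (obj t) (obj w)).
rewrite (hat_comp (t := Node s (Node w t))) (hat_comp (t := Node (Node t w) s)).
rewrite (hat_whiskl _ (t := Node t w) (t' := Node w t)).
by rewrite (hat_whiskr (s := Node t w) (s' := Node w t)).
Qed.

Lemma hat_swap s t w Z :
  hat (s := Node s (Node t w)) (t := Node t (Node s w))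
    (swap (obj s) (obj t) (obj w)) Z = hat_braid s t (act w Z).
Proof.
rewrite swapE.
rewrite (hat_comp (t := Node (Node s t) w)) (hat_comp (t := Node (Node t s) w)).
by rewrite hat_braidE hat_assoc hat_assocV comp_idl comp_idr
           (hat_whiskr (s := Node s t) (s' := Node t s)).
Qed.

Lemma hat_interchange s t u w Z :
  hat (s := Node (Node s t) (Node u w)) (t := Node (Node s u) (Node t w))
    (interchange (obj s) (obj t) (obj u) (obj w)) Z = actm s (hat_braid t u (act w Z)).
Proof.
rewrite interchangeE (hat_comp (t := Node s (Node t (Node u w))))
        (hat_comp (t := Node s (Node u (Node t w)))).
rewrite (hat_assoc s t (Node u w)) (hat_assocV s u (Node t w)) comp_idl comp_idr.
by rewrite (hat_whiskl _ (t := Node t (Node u w)) (t' := Node u (Node t w)))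
           hat_swap.
Qed.

Lemma hat_braidK s t Z :
  monodromy (obj s) (obj t) = idm _ -> hat_braid t s Z ∘ hat_braid s t Z = idm _.
Proof.
rewrite !hat_braidE => /(congr1 (fun f => hat (s := Node s t) (t := Node s t) f Z)).
rewrite (hat_comp (s := Node s t) (t := Node t s) (w := Node s t)) => e.
exact: etrans e (hat_id (Node s t) Z).
Qed.

Section SwapInterchange.
Variables a b c d x y : @shape R C.
Hypothesis bc_transparent : monodromy (obj b) (obj c) = idm (obj b ⊗ obj c).

(** In the image of the Cayley embedding both sides are braids on the strands
    [a b x c d y].  On the left, [b] crosses [c] twice; once this is cancelled,
    both sides differ by a Yang-Baxter move on [x c d]. *)
Lemma swap_interchange_shape :
  swap (obj (Node a c)) (obj (Node b d)) (obj (Node x y))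
    ∘ (idm (obj (Node a c)) ⊠ interchange (obj b) (obj x) (obj d) (obj y))
    ∘ interchange (obj a) (obj (Node b x)) (obj c) (obj (Node d y))
  = (idm (obj (Node b d)) ⊠ interchange (obj a) (obj x) (obj c) (obj y))
    ∘ interchange (obj b) (obj (Node a x)) (obj d) (obj (Node c y))
    ∘ (swap (obj a) (obj b) (obj x) ⊠ swap (obj c) (obj d) (obj y)).
Proof.
apply: (hat_inj (s := Node (Node a (Node b x)) (Node c (Node d y)))
  (t := Node (Node b d) (Node (Node a c) (Node x y)))) => Z.
rewrite (hat_comp (t := Node (Node a c) (Node (Node b x) (Node d y))))
        (hat_comp (t := Node (Node a c) (Node (Node b d) (Node x y)))).
rewrite (hat_swap (Node a c) (Node b d) (Node x y)).
rewrite (hat_whiskl (Node a c) (t := Node (Node b x) (Node d y))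
   (t' := Node (Node b d) (Node x y))).
rewrite hat_interchange (hat_interchange a (Node b x) c (Node d y)).
rewrite (hat_comp (t := Node (Node b (Node a x)) (Node d (Node c y))))
        (hat_comp (t := Node (Node b d) (Node (Node a x) (Node c y)))).
rewrite (hat_whiskl (Node b d) (t := Node (Node a x) (Node c y))
   (t' := Node (Node a c) (Node x y))).
rewrite hat_interchange (hat_interchange b (Node a x) d (Node c y)).
rewrite (hat_tens (s := Node a (Node b x)) (s' := Node b (Node a x))
  (t := Node c (Node d y)) (t' := Node d (Node c y))) !hat_swap.
rewrite !hat_braid_tensr !hat_braid_tensl /=; set W := act y Z.
(* The braid in which [b] and [c] no longer cross, with the crossings of
   [x c d] collected next to each other. *)
transitivity (actm b (hat_braid a d (act c (act x W)))
    ∘ (actm b (actm a (hat_braid c d (act x W)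
                         ∘ actm c (hat_braid x d W) ∘ hat_braid x c (act d W)))
       ∘ hat_braid a b (act x (act c (act d W))))).
  rewrite -[hat_braid c d _ ∘ _ ∘ _]compA -[actm a (_ ∘ (_ ∘ _))]actm_comp.
  rewrite -[actm b (actm a _ ∘ _)]actm_comp.
  rewrite -[actm b (hat_braid a d _ ∘ _)]actm_comp.
  rewrite -!compA; do 2!congr (_ ∘ _).
  rewrite -hat_braid_nat; congr (_ ∘ _); rewrite !actm_comp; congr (actm a _).
  rewrite compA hat_braid_nat -!compA (reassoc (hat_braidK _ _)) //.
  by rewrite comp_idl actm_comp.
rewrite -yang_baxter hat_braid_nat -[actm d _ ∘ _ ∘ _]compA -![actm a (_ ∘ _)]actm_comp.
rewrite -![actm b (actm a _ ∘ _)]actm_comp -[actm b (hat_braid a d _ ∘ _)]actm_comp.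
by rewrite -!compA (reassoc (actm_comp _ _ _)) hat_braid_nat -actm_comp -!compA.
Qed.
End SwapInterchange.

(** With powers of [g] for [a], [c] and powers of [h] for [b], [d], this is why
    the braiding on the summands is monoidal. *)
Lemma swap_interchange (a b c d X Y : C) :
  monodromy b c = idm (b ⊗ c) ->
  swap (a ⊗ c) (b ⊗ d) (X ⊗ Y) ∘ (idm (a ⊗ c) ⊠ interchange b X d Y)
    ∘ interchange a (b ⊗ X) c (d ⊗ Y)
  = (idm (b ⊗ d) ⊠ interchange a X c Y) ∘ interchange b (a ⊗ X) d (c ⊗ Y)
    ∘ (swap a b X ⊠ swap c d Y).
Proof.
move=> bc; exact: (@swap_interchange_shape
  (Leaf a) (Leaf b) (Leaf c) (Leaf d) (Leaf X) (Leaf Y) bc).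
Qed.

Lemma swap_nat X X' Y Y' Z Z' (f : hom X X') (g : hom Y Y') (h : hom Z Z') :
  swap X' Y' Z' ∘ (f ⊠ (g ⊠ h)) = (g ⊠ (f ⊠ h)) ∘ swap X Y Z.
Proof.
rewrite !swapE -!compA assocV_nat.
rewrite !compA -assoc_nat -!compA; congr (_ ∘ _); rewrite !compA.
by congr (_ ∘ _); rewrite -!tensm_comp braid_nat comp_idl comp_idr.
Qed.

Lemma interchange_nat X X' Y Y' Z Z' W W'
    (f : hom X X') (g : hom Y Y') (h : hom Z Z') (k : hom W W') :
  interchange X' Y' Z' W' ∘ ((f ⊠ g) ⊠ (h ⊠ k))
  = ((f ⊠ h) ⊠ (g ⊠ k)) ∘ interchange X Y Z W.
Proof.
rewrite !interchangeE -!compA assoc_nat !compA -assocV_nat -!compA.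
congr (_ ∘ _); rewrite !compA; congr (_ ∘ _).
by rewrite -!tensm_comp swap_nat comp_idl comp_idr.
Qed.

Lemma swapK X Y Z :
  monodromy X Y = idm (X ⊗ Y) -> swap Y X Z ∘ swap X Y Z = idm _.
Proof.
move=> dXY; rewrite !swapE -!compA (reassoc (assocVK _ _ _)) comp_idl.
rewrite (reassoc (whiskr_comp _ _ _)) -/(monodromy X Y) dXY tensm_id comp_idl.
exact: assocKV.
Qed.

Lemma monodromy_sym X Y : monodromy X Y = idm _ -> monodromy Y X = idm _.
Proof.
move=> dXY; apply: (iso_epi (braid_iso X Y)).
by rewrite /monodromy -compA -/(monodromy X Y) dXY comp_idl comp_idr.
Qed.

(** The hexagon with two units, followed by a unit isomorphism, reduces by
    naturality to the claim tensored with the unit. *)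
Lemma braid_unitr X : lunit X ∘ braid X 𝟙 = runit X.
Proof.
apply: whiskr_unit_inj; apply: (iso_mono (braid_iso X 𝟙)).
have /(congr1 (comp (lunit (𝟙 ⊗ X)))) := hexagon1 X 𝟙 𝟙.
rewrite !compA lunit_tens -braid_nat -compA triangle => ->.
by rewrite lunit_nat -!compA (reassoc (lunit_tens _ _)) whiskr_comp.
Qed.

Lemma braid_unitl X : runit X ∘ braid 𝟙 X = lunit X.
Proof.
apply: whiskl_unit_inj; apply: (iso_mono (braid_iso 𝟙 X)).
have /(congr1 (comp (runit (X ⊗ 𝟙)))) := hexagon2 𝟙 𝟙 X.
have triangleV Y : (runit 𝟙 ⊠ idm Y) ∘ assocV 𝟙 𝟙 Y = idm 𝟙 ⊠ lunit Y.
  by rewrite -triangle -compA assocKV comp_idr.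
have runit_tensV Y Z : runit (Y ⊗ Z) ∘ assocV Y Z 𝟙 = idm Y ⊠ runit Z.
  by rewrite -runit_tens -compA assocKV comp_idr.
rewrite !compA runit_tensV -braid_nat -compA triangleV => ->.
by rewrite runit_nat -!compA (reassoc (runit_tensV _ _)) whiskl_comp.
Qed.

Lemma monodromy_unit X : monodromy X 𝟙 = idm _.
Proof.
apply: (iso_mono (iso_runit X)).
by rewrite /monodromy compA braid_unitl braid_unitr comp_idr.
Qed.

(** On its way around [X ⊗ Y], the strand [Z] crosses [Y], winds around [X] and
    crosses [Y] again; when the middle part is trivial, winding around [Y]
    remains.  With [X] a power of [h] and [Z] equal to [g], this says that
    tensoring with [X] preserves the degree for [g]. *)
Lemma monodromy_tensl X Y Z (a : R[i]) :
  monodromy X Z = idm _ -> monodromy Y Z = a *: idm _ ->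
  monodromy (X ⊗ Y) Z = a *: idm _.
Proof.
pose x := Leaf X; pose y := Leaf Y; pose z := Leaf Z => dX dY.
pose xyz := Node (Node x y) z.
apply: (hat_inj (s := xyz) (t := xyz)) => W.
have -> : hat (s := xyz) (t := xyz) (monodromy (X ⊗ Y) Z) W
   = hat_braid z (Node x y) W ∘ hat_braid (Node x y) z W.
  by rewrite !hat_braidE; apply: (hat_comp (t := Node z (Node x y))).
rewrite hat_braid_tensr hat_braid_tensl -!compA.
rewrite (reassoc (@hat_braidK x z _ dX)) comp_idl (actm_comp x).
have -> : hat_braid z y W ∘ hat_braid y z W = a *: idm _.
  rewrite !hat_braidE -(hat_comp (s := Node y z) (t := Node z y) (w := Node y z)).
  have := congr1 (fun f => hat (s := Node y z) (t := Node y z) f W) dY.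
  by move=> e; apply: etrans e _; rewrite hatZ (hat_id (Node y z)).
rewrite (hatZ (s := xyz) (t := xyz)) (hat_id xyz) /=.
by rewrite tensmZr tensm_id.
Qed.

Lemma monodromy_tpow g X n : monodromy g X = idm _ -> monodromy (tpow g n) X = idm _.
Proof.
move=> dgX; elim: n => [|n IHn] /=; first exact: monodromy_sym (monodromy_unit X).
by rewrite -[RHS]scale1r; apply: monodromy_tensl; rewrite ?scale1r.
Qed.

(** Tensoring further with an inverse of [g] amounts to tensoring with the
    unit, which is faithful. *)
Lemma whiskr_invertible_inj g X Y (f f' : hom X Y) :
  invertible g -> f ⊠ idm g = f' ⊠ idm g -> f = f'.
Proof.
case=> g' [[u u_iso] _] e; apply: whiskr_unit_inj.
apply: (iso_epi (iso_tensm (iso_idm X) u_iso)).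
rewrite !whisk_rl -[f ⊠ u]whisk_lr -[f' ⊠ u]whisk_lr; congr (_ ∘ _).
apply: (iso_epi (iso_assoc X g g')).
by rewrite -tensm_id -!assoc_nat e.
Qed.

End Braided.

(** * One grading and its simple current functor *)

Section Grading.
Context {R : realType} {C : modular_tensor_category R}.
Implicit Types X Y Z W : C.
Variables (g : C) (M : nat) (zeta : R[i]).
Hypothesis g_inv : invertible g.
Hypothesis zeta_prim : M.-primitive_root zeta.

(** Sliding [f] through the monodromy with [g] multiplies [f ⊠ idm g] by both
    [zeta ^+ m] and [zeta ^+ n], which are different scalars. *)
Lemma hom_in_degree_neq X Y (m n : 'I_M) (f : hom X Y) :
  in_degree g zeta m X -> in_degree g zeta n Y -> m != n -> f = 0.
Proof.
move=> dX dY mn; apply: (whiskr_invertible_inj g_inv); rewrite tensm0l.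
have e : monodromy Y g ∘ (f ⊠ idm g) = (f ⊠ idm g) ∘ monodromy X g.
  by rewrite /monodromy -compA braid_nat !compA braid_nat.
move: e; rewrite /monodromy dX dY compZl compZr comp_idl comp_idr => /eqP.
rewrite -subr_eq0 -scalerBl scaler_eq0 subr_eq0 (eq_prim_root_expr zeta_prim).
by rewrite !modn_small // eq_sym -[_ == _ :> nat]/(m == n) (negPf mn) => /eqP.
Qed.

Variable D : homogeneous_decomposition g M zeta.
Local Notation dec X := (decomposition D X).

Definition homog_proj (m : 'I_M) X : hom X X := locked (inj (dec X) m ∘ prj (dec X) m).

Lemma homog_projE m X : homog_proj m X =
  inj (dec X) m ∘ prj (dec X) m.
Proof. by rewrite /homog_proj -lock. Qed.

Lemma prj_inj_neq m n X Y (f : hom X Y) :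
  m != n -> prj (dec Y) m ∘ f ∘ inj (dec X) n = 0.
Proof.
move=> mn; apply: hom_in_degree_neq (componentP D X n) (componentP D Y m) _.
by rewrite eq_sym.
Qed.

Lemma homog_proj_nat m X Y (f : hom X Y) :
  homog_proj m Y ∘ f = f ∘ homog_proj m X.
Proof.
transitivity (homog_proj m Y ∘ f ∘ homog_proj m X).
  rewrite -[LHS]comp_idr -(sum_inj_prj (dec X)) comp_sumr.
  rewrite (big_only1 m) -?homog_projE // => n nm _; rewrite !homog_projE.
  rewrite -!compA [prj _ _ ∘ (f ∘ _)]compA.
  rewrite [_ ∘ (inj _ n ∘ _)]compA.
  by rewrite prj_inj_neq 1?eq_sym // comp0l comp0r.
rewrite -[RHS]comp_idl -(sum_inj_prj (dec Y)) comp_suml.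
rewrite (big_only1 m) -?homog_projE ?compA // => n nm _; rewrite !homog_projE.
rewrite -!compA [prj _ _ ∘ (f ∘ _)]compA [_ ∘ (inj _ m ∘ _)]compA.
by rewrite prj_inj_neq // comp0l comp0r.
Qed.

Lemma homog_projK m X : homog_proj m X ∘ homog_proj m X = homog_proj m X.
Proof. by rewrite !homog_projE compA -[_ ∘ _ ∘ inj _ _]compA prj_inj comp_idr. Qed.

Lemma homog_proj_in_degree (m n : 'I_M) X :
  in_degree g zeta n X -> homog_proj m X = if m == n then idm X else 0.
Proof.
move=> dX; have proj0 k : k != n -> homog_proj k X = 0.
  move=> kn; rewrite !homog_projE.
  rewrite (hom_in_degree_neq (prj (dec X) k) dX (componentP D X k)) ?comp0r //.
  by rewrite eq_sym.
case: eqP => [->|/eqP/proj0//].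
rewrite -(sum_inj_prj (dec X)) (big_only1 n) -?homog_projE // => k /proj0.
by rewrite homog_projE.
Qed.

(** [T ⊗ X] is the sum of the [T ⊗ X_m], and these are homogeneous of the same
    degrees as the [X_m]. *)
Lemma homog_proj_tens m T X :
  monodromy T g = idm _ -> homog_proj m (T ⊗ X) = idm T ⊠ homog_proj m X.
Proof.
move=> dT; rewrite -[LHS]comp_idr -tensm_id -(sum_inj_prj (dec X)).
rewrite tensm_sumr comp_sumr (big_only1 m) // => [|n nm _].
  rewrite -whiskl_comp compA homog_proj_nat (homog_proj_in_degree _ (n := m)).
    by rewrite eqxx comp_idr whiskl_comp homog_projE.
  exact: monodromy_tensl dT (componentP D X m).
rewrite -whiskl_comp compA homog_proj_nat (homog_proj_in_degree _ (n := n)).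
  by rewrite eq_sym (negPf nm) comp0r comp0l.
exact: monodromy_tensl dT (componentP D X n).
Qed.

(** [to_summand] and [of_summand] present [F_g X] as a retract of the sum of the
    [g^m ⊗ X], which unlike the summands [g^m ⊗ X_m] are functorial in [X]
    without any choice. *)
Definition to_summand (m : 'I_M) X : hom (sc_ob D X) (tpow g m ⊗ X) :=
  locked ((idm (tpow g m) ⊠ inj (dec X) m) ∘ prj (sc_sum D X) m).

Lemma to_summandE m X : to_summand m X =
  (idm (tpow g m) ⊠ inj (dec X) m) ∘ prj (sc_sum D X) m.
Proof. by rewrite /to_summand -lock. Qed.

Definition of_summand (m : 'I_M) X : hom (tpow g m ⊗ X) (sc_ob D X) :=
  locked (inj (sc_sum D X) m ∘ (idm (tpow g m) ⊠ prj (dec X) m)).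

Lemma of_summandE m X : of_summand m X =
  inj (sc_sum D X) m ∘ (idm (tpow g m) ⊠ prj (dec X) m).
Proof. by rewrite /of_summand -lock. Qed.

Lemma sum_of_to_summand X : \sum_(m < M) of_summand m X ∘ to_summand m X = idm _.
Proof.
rewrite -(sum_inj_prj (sc_sum D X)); apply: eq_bigr => m _.
rewrite !of_summandE !to_summandE -!compA (reassoc (whiskl_comp _ _ _)).
by rewrite prj_inj tensm_id comp_idl.
Qed.

Lemma of_summand_proj (m : 'I_M) X :
  of_summand m X ∘ (idm _ ⊠ homog_proj m X) = of_summand m X.
Proof.
rewrite !of_summandE !homog_projE -compA whiskl_comp compA prj_inj comp_idl //.
Qed.

Lemma of_summand_nat (m : 'I_M) X Y (f : hom X Y) :
  sc_map D f ∘ of_summand m X = of_summand m Y ∘ (idm _ ⊠ f).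
Proof.
rewrite /sc_map comp_suml (big_only1 m) // => [|n nm _].
  rewrite !of_summandE -!compA (reassoc (prj_inj _ _)) comp_idl !whiskl_comp.
  rewrite -!compA -homog_projE -homog_proj_nat.
  by rewrite homog_projE -compA (reassoc (prj_inj _ _)) comp_idl.
by rewrite !of_summandE -!compA (reassoc (prj_inj0 _ nm)) comp0l !comp0r.
Qed.

Lemma prj_of_summand (m : 'I_M) X :
  prj (sc_sum D X) m ∘ of_summand m X = idm _ ⊠ prj (dec X) m.
Proof. by rewrite !of_summandE compA prj_inj comp_idl. Qed.

Lemma prj_of_summand_neq (m n : 'I_M) X : m != n -> prj (sc_sum D X) m ∘ of_summand n X = 0.
Proof. by move=> mn; rewrite !of_summandE compA prj_inj0 // comp0l. Qed.

Lemma to_of_summand (m : 'I_M) X :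
  to_summand m X ∘ of_summand m X = idm _ ⊠ homog_proj m X.
Proof. by rewrite to_summandE -compA prj_of_summand whiskl_comp homog_projE. Qed.

Lemma to_of_summand_neq (m n : 'I_M) X :
  m != n -> to_summand m X ∘ of_summand n X = 0.
Proof. by move=> mn; rewrite !to_summandE -compA prj_of_summand_neq // comp0r. Qed.

Variables (q : R[i]) (v : power_basis g M q).

Lemma sc_tauE (m n k : 'I_M) X Y :
  sc_tau v m n k X Y
  = (pb v m n k ⊠ idm (X ⊗ Y)) ∘ interchange (tpow g m) X (tpow g n) Y.
Proof. by rewrite /sc_tau interchangeE swapE !compA. Qed.

Lemma sc_str_of_summand (m n k : 'I_M) X Y : k = m + n %[mod M] ->
  sc_str D v X Y ∘ (of_summand m X ⊠ of_summand n Y)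
  = of_summand k (X ⊗ Y) ∘ (pb v m n k ⊠ idm (X ⊗ Y))
      ∘ interchange (tpow g m) X (tpow g n) Y
      ∘ ((idm _ ⊠ homog_proj m X) ⊠ (idm _ ⊠ homog_proj n Y)).
Proof.
move=> kE; rewrite /sc_str comp_suml (big_only1 m) // => [|m' m'm _].
  rewrite comp_suml (big_only1 n) // => [|n' n'n _].
    rewrite (big_pred1 k) => [|k']; last by rewrite /= -kE !modn_small.
    rewrite sc_tauE -!compA -tensm_comp !prj_of_summand.
    rewrite !of_summandE -!compA; congr (_ ∘ _).
    rewrite -whiskl_comp -!compA; congr (_ ∘ _).
    rewrite !homog_projE -!whiskl_comp !(tensm_comp (idm _ ⊠ _) _ (idm _ ⊠ _) _).
    rewrite [in RHS](reassoc (interchange_nat _ _ _ _)) tensm_id -!compA.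
    by rewrite !(reassoc (whisk_lr _ _)) !(reassoc (whisk_rl _ _)).
  rewrite comp_suml big1 // => k' _.
  by rewrite -compA -tensm_comp (prj_of_summand_neq _ n'n) tensm0r comp0r.
rewrite comp_suml big1 // => n' _; rewrite comp_suml big1 // => k' _.
by rewrite -compA -tensm_comp (prj_of_summand_neq _ m'm) tensm0l comp0r.
Qed.

End Grading.

(** * The composite of two simple current functors *)

Section Composite.
Context {R : realType} {C : modular_tensor_category R}.
Implicit Types X Y Z W : C.
Variables (g h : C) (M N : nat) (zg zh qg qh : R[i]).
Hypotheses (g_inv : invertible g) (h_inv : invertible h).
Hypotheses (zg_prim : M.-primitive_root zg) (zh_prim : N.-primitive_root zh).
Hypothesis hg_transparent : monodromy h g = idm (h ⊗ g).
Variables (Dg : homogeneous_decomposition g M zg).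
Variables (Dh : homogeneous_decomposition h N zh).
Variables (vg : power_basis g M qg) (vh : power_basis h N qh).

Local Notation F := (mcomp (simple_current Dg vg) (simple_current Dh vh)).

Definition bihomog_proj (m : 'I_M) (n : 'I_N) X : hom X X :=
  locked (homog_proj Dg m X ∘ homog_proj Dh n X).

Lemma bihomog_projE m n X : bihomog_proj m n X =
  homog_proj Dg m X ∘ homog_proj Dh n X.
Proof. by rewrite /bihomog_proj -lock. Qed.

Definition to_bisummand (m : 'I_M) (n : 'I_N) X : hom (F X) (tpow g m ⊗ (tpow h n ⊗ X)) :=
  locked ((idm (tpow g m) ⊠ to_summand Dh n X) ∘ to_summand Dg m (sc_ob Dh X)).

Lemma to_bisummandE m n X : to_bisummand m n X =
  (idm (tpow g m) ⊠ to_summand Dh n X) ∘ to_summand Dg m (sc_ob Dh X).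
Proof. by rewrite /to_bisummand -lock. Qed.

Definition of_bisummand (m : 'I_M) (n : 'I_N) X : hom (tpow g m ⊗ (tpow h n ⊗ X)) (F X) :=
  locked (of_summand Dg m (sc_ob Dh X) ∘ (idm (tpow g m) ⊠ of_summand Dh n X)).

Lemma of_bisummandE m n X : of_bisummand m n X =
  of_summand Dg m (sc_ob Dh X) ∘ (idm (tpow g m) ⊠ of_summand Dh n X).
Proof. by rewrite /of_bisummand -lock. Qed.

Lemma sum_of_to_bisummand X :
  \sum_(m < M) \sum_(n < N) of_bisummand m n X ∘ to_bisummand m n X = idm (F X).
Proof.
rewrite -[RHS](sum_of_to_summand Dg); apply: eq_bigr => m _.
rewrite -[of_summand Dg m _ in RHS]comp_idr -tensm_id.
rewrite -[in RHS](sum_of_to_summand Dh) tensm_sumr comp_sumr comp_suml.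
apply: eq_bigr => n _; rewrite !of_bisummandE !to_bisummandE.
by rewrite -whiskl_comp !compA.
Qed.

(** This and the next lemma reduce equations between morphisms out of [F X] and
    [F X ⊗ F Y] to the summands. *)
Lemma of_bisummand_epi X W (u w : hom (F X) W) :
  (forall m n, u ∘ of_bisummand m n X = w ∘ of_bisummand m n X) -> u = w.
Proof.
move=> uw; rewrite -[u]comp_idr -[w]comp_idr -sum_of_to_bisummand !comp_sumr.
apply: eq_bigr => m _; rewrite !comp_sumr; apply: eq_bigr => n _.
by rewrite !compA uw.
Qed.

Lemma of_bisummand_tens_epi X Y W (u w : hom (F X ⊗ F Y) W) :
  (forall m n m' n', u ∘ (of_bisummand m n X ⊠ of_bisummand m' n' Y)
                   = w ∘ (of_bisummand m n X ⊠ of_bisummand m' n' Y)) -> u = w.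
Proof.
move=> uw; rewrite -[u]comp_idr -[w]comp_idr -tensm_id -!sum_of_to_bisummand.
rewrite !tensm_suml !comp_sumr; apply: eq_bigr => m _.
rewrite !tensm_suml !comp_sumr; apply: eq_bigr => n _.
rewrite !tensm_sumr !comp_sumr; apply: eq_bigr => m' _.
rewrite !tensm_sumr !comp_sumr; apply: eq_bigr => n' _.
by rewrite tensm_comp !compA uw.
Qed.

Lemma of_bisummand_nat (m : 'I_M) (n : 'I_N) X Y (f : hom X Y) :
  fmap F f ∘ of_bisummand m n X
  = of_bisummand m n Y ∘ (idm (tpow g m) ⊠ (idm (tpow h n) ⊠ f)).
Proof.
rewrite /= !of_bisummandE compA (of_summand_nat g_inv zg_prim) -compA whiskl_comp.
by rewrite (of_summand_nat h_inv zh_prim) -whiskl_comp compA.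
Qed.

Lemma homog_proj_tpow (m : 'I_M) (n : 'I_N) X :
  homog_proj Dg m (tpow h n ⊗ X) = idm (tpow h n) ⊠ homog_proj Dg m X.
Proof. by apply: (homog_proj_tens g_inv zg_prim); apply: monodromy_tpow. Qed.

(** The projector of [F_h X] for the grading by [g] acts on the summand
    [h^n ⊗ X] through the one of [X]: this is where the trivial monodromy of
    [g] and [h] makes the two gradings compatible. *)
Lemma homog_proj_of_summand (m : 'I_M) (n : 'I_N) X :
  homog_proj Dg m (sc_ob Dh X) ∘ of_summand Dh n X
  = of_summand Dh n X ∘ (idm (tpow h n) ⊠ bihomog_proj m n X).
Proof.
rewrite (homog_proj_nat g_inv zg_prim) homog_proj_tpow.
rewrite -{1}of_summand_proj -compA whiskl_comp !bihomog_projE.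
by rewrite (homog_proj_nat g_inv zg_prim).
Qed.

Lemma of_bisummand_proj (m : 'I_M) (n : 'I_N) X :
  of_bisummand m n X ∘ (idm _ ⊠ (idm _ ⊠ bihomog_proj m n X)) = of_bisummand m n X.
Proof.
rewrite !of_bisummandE -compA whiskl_comp -homog_proj_of_summand.
by rewrite -whiskl_comp compA of_summand_proj.
Qed.

Lemma to_of_bisummand (m : 'I_M) (n : 'I_N) X :
  to_bisummand m n X ∘ of_bisummand m n X = idm _ ⊠ (idm _ ⊠ bihomog_proj m n X).
Proof.
rewrite !to_bisummandE !of_bisummandE -!compA (reassoc (to_of_summand _ _ _)).
rewrite !whiskl_comp homog_proj_of_summand compA to_of_summand whiskl_comp.
rewrite !bihomog_projE (homog_proj_nat g_inv zg_prim) compA.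
by rewrite homog_projK.
Qed.

Lemma to_of_bisummand_neq (m m' : 'I_M) (n n' : 'I_N) X :
  (m, n) != (m', n') -> to_bisummand m n X ∘ of_bisummand m' n' X = 0.
Proof.
rewrite !to_bisummandE !of_bisummandE -!compA.
case: (eqVneq m m') => [<-|mm'] nn'; last first.
  by rewrite (reassoc (to_of_summand_neq _ _ mm')) comp0l comp0r.
rewrite (reassoc (to_of_summand _ _ _)) !whiskl_comp homog_proj_of_summand compA.
rewrite to_of_summand_neq ?comp0l ?tensm0r //.
by apply: contraNneq nn' => ->.
Qed.

Lemma homog_proj_bihomog m n X :
  homog_proj Dh n X ∘ bihomog_proj m n X = bihomog_proj m n X.
Proof.
by rewrite !bihomog_projE (homog_proj_nat g_inv zg_prim) compA homog_projK.
Qed.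

(** The structure map of the composite performs the interchange of the powers
    of [g] with [h^n ⊗ X], then that of the powers of [h] with [X]. *)
Lemma fstr_of_bisummand (m m' k : 'I_M) (n n' l : 'I_N) X Y :
  k = m + m' %[mod M] -> l = n + n' %[mod N] ->
  fstr F X Y ∘ (of_bisummand m n X ⊠ of_bisummand m' n' Y)
  = of_bisummand k l (X ⊗ Y)
      ∘ (pb vg m m' k ⊠ (pb vh n n' l ⊠ idm (X ⊗ Y)))
      ∘ (idm _ ⊠ interchange (tpow h n) X (tpow h n') Y)
      ∘ interchange (tpow g m) (tpow h n ⊗ X) (tpow g m') (tpow h n' ⊗ Y)
      ∘ ((idm _ ⊠ (idm _ ⊠ bihomog_proj m n X))
           ⊠ (idm _ ⊠ (idm _ ⊠ bihomog_proj m' n' Y))).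
Proof.
move=> kE lE; rewrite /= !of_bisummandE tensm_comp -!compA.
rewrite (reassoc (sc_str_of_summand Dg vg _ _ kE)) -!compA.
rewrite (reassoc (of_summand_nat g_inv zg_prim _ _ _)) -!compA.
congr (_ ∘ _).
rewrite -tensm_comp !whiskl_comp !homog_proj_of_summand.
rewrite -!whiskl_comp tensm_comp (reassoc (interchange_nat _ _ _ _)) tensm_id.
rewrite -!compA (reassoc (whisk_lr _ _)) (reassoc (esym (tensm_comp _ _ _ _))).
rewrite comp_idr (sc_str_of_summand Dh vh _ _ lE).
(* The projectors for [h] are separated from the other factors, to be moved to
   the right end and absorbed there. *)
transitivity ((idm _ ⊠ of_summand Dh l (X ⊗ Y))
  ∘ ((pb vg m m' k ⊠ (pb vh n n' l ⊠ idm (X ⊗ Y)))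
  ∘ ((idm _ ⊠ interchange (tpow h n) X (tpow h n') Y)
  ∘ ((idm _ ⊠ ((idm _ ⊠ homog_proj Dh n X) ⊠ (idm _ ⊠ homog_proj Dh n' Y)))
  ∘ (interchange (tpow g m) (tpow h n ⊗ X) (tpow g m') (tpow h n' ⊗ Y)
  ∘ ((idm _ ⊠ (idm _ ⊠ bihomog_proj m n X))
       ⊠ (idm _ ⊠ (idm _ ⊠ bihomog_proj m' n' Y)))))))).
  rewrite !compA; congr (_ ∘ _ ∘ _).
  by rewrite -!tensm_comp !comp_idl !comp_idr.
do 3!congr (_ ∘ _); rewrite -tensm_id compA -interchange_nat -compA.
by rewrite -tensm_comp !whiskl_comp !homog_proj_bihomog.
Qed.

End Composite.

(** * The exchange isomorphism *)

Section Exchange.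
Context {R : realType} {C : modular_tensor_category R}.
Implicit Types X Y : C.
Variables (g h : C) (M N : nat) (zg zh qg qh : R[i]).
Hypotheses (g_inv : invertible g) (h_inv : invertible h).
Hypotheses (zg_prim : M.-primitive_root zg) (zh_prim : N.-primitive_root zh).
Hypothesis gh_transparent : monodromy g h = idm (g ⊗ h).
Variables (Dg : homogeneous_decomposition g M zg).
Variables (Dh : homogeneous_decomposition h N zh).
Variables (vg : power_basis g M qg) (vh : power_basis h N qh).

Local Notation F := (mcomp (simple_current Dg vg) (simple_current Dh vh)).
Local Notation G := (mcomp (simple_current Dh vh) (simple_current Dg vg)).
Local Notation ofF := (of_bisummand Dg Dh vg vh).
Local Notation ofG := (of_bisummand Dh Dg vh vg).

Let hg_transparent : monodromy h g = idm (h ⊗ g) := monodromy_sym gh_transparent.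

Definition exchange X : hom (F X) (G X) :=
  \sum_(m < M) \sum_(n < N)
    ofG n m X ∘ swap (tpow g m) (tpow h n) X ∘ to_bisummand Dg Dh vg vh m n X.

Lemma bihomog_projC m n X : bihomog_proj Dh Dg n m X = bihomog_proj Dg Dh m n X.
Proof. by rewrite !bihomog_projE (homog_proj_nat g_inv zg_prim). Qed.

(** The bihomogeneous projector left over on the summand commutes with [swap]
    and is absorbed by the inclusion of the target. *)
Lemma exchange_of_summand (m : 'I_M) (n : 'I_N) X :
  exchange X ∘ ofF m n X = ofG n m X ∘ swap (tpow g m) (tpow h n) X.
Proof.
rewrite /exchange comp_suml (big_only1 m) // => [|m' m'm _].
  rewrite comp_suml (big_only1 n) // => [|n' n'n _].
    rewrite -!compA (to_of_bisummand g_inv zg_prim hg_transparent).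
    rewrite swap_nat -bihomog_projC compA.
    by rewrite (of_bisummand_proj h_inv zh_prim gh_transparent).
  rewrite -!compA (to_of_bisummand_neq g_inv zg_prim hg_transparent) ?comp0r //.
  by apply: contraNneq n'n => -[->].
rewrite comp_suml big1 // => n' _.
rewrite -!compA (to_of_bisummand_neq g_inv zg_prim hg_transparent) ?comp0r //.
by apply: contraNneq m'm => -[->].
Qed.

Lemma exchange_nat X Y (f : hom X Y) :
  exchange Y ∘ fmap F f = fmap G f ∘ exchange X.
Proof.
apply: of_bisummand_epi => m n.
rewrite -!compA (of_bisummand_nat g_inv h_inv zg_prim zh_prim).
rewrite exchange_of_summand compA exchange_of_summand -compA swap_nat.
by rewrite !compA (of_bisummand_nat h_inv g_inv zh_prim zg_prim).
Qed.

Lemma monodromy_tpow_tpow m n :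
  monodromy (tpow g m) (tpow h n) = idm (tpow g m ⊗ tpow h n).
Proof. exact/monodromy_tpow/monodromy_sym/monodromy_tpow. Qed.

(** On the summands, naturality moves the exchange past the multiplications of
    powers, and what remains is [swap_interchange]. *)
Lemma exchange_monoidal X Y :
  exchange (X ⊗ Y) ∘ fstr F X Y = fstr G X Y ∘ (exchange X ⊠ exchange Y).
Proof.
apply: of_bisummand_tens_epi => m n m' n'.
have M_gt0 : (0 < M)%N := leq_ltn_trans (leq0n m) (ltn_ord m).
have N_gt0 : (0 < N)%N := leq_ltn_trans (leq0n n) (ltn_ord n).
pose k := Ordinal (ltn_pmod (m + m') M_gt0).
pose l := Ordinal (ltn_pmod (n + n') N_gt0).
have kE : k = m + m' %[mod M] by rewrite modn_mod.
have lE : l = n + n' %[mod N] by rewrite modn_mod.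
rewrite -[LHS]compA.
rewrite (fstr_of_bisummand g_inv zg_prim hg_transparent _ _ _ _ _ _ kE lE).
rewrite -[RHS]compA -tensm_comp !exchange_of_summand tensm_comp [RHS]compA.
rewrite (fstr_of_bisummand h_inv zh_prim gh_transparent _ _ _ _ _ _ lE kE).
rewrite -!compA (reassoc (exchange_of_summand _ _ _)).
rewrite -!compA; congr (_ ∘ _).
rewrite (reassoc (swap_nat _ _ _)) -!compA; congr (_ ∘ _).
rewrite -tensm_comp -!swap_nat !bihomog_projC tensm_comp !compA.
by rewrite swap_interchange //; apply: monodromy_sym (monodromy_tpow_tpow _ _).
Qed.

End Exchange.

Theorem proposition3p8 (R : realType) (C : modular_tensor_category R)
  (g h : C) (hg : invertible g) (hh : invertible h)
  (M N : nat) (hM : has_order g M) (hN : has_order h N)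
  (hgh : braid h g ∘ braid g h = idm (g ⊗ h))
  (qg qh : R[i])
  (hqg : braid g g = qg *: idm (g ⊗ g))
  (hqh : braid h h = qh *: idm (h ⊗ h))
  (* the multiplicative orders of qg ^+ 2 and qh ^+ 2 *)
  (dg dh : nat)
  (hdg : dg.-primitive_root (qg ^+ 2)) (hdh : dh.-primitive_root (qh ^+ 2))
  (hAg : coprime (M %/ dg + 1) M) (hAh : coprime (N %/ dh + 1) N)
  (zg zh : R[i])
  (hzg : M.-primitive_root zg) (hzh : N.-primitive_root zh)
  (hzgA : zg ^+ (M %/ dg) = qg ^+ 2) (hzhA : zh ^+ (N %/ dh) = qh ^+ 2)
  (* the choices entering the definition of the two functors *)
  (Dg : homogeneous_decomposition g M zg) (Dh : homogeneous_decomposition h N zh)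
  (vg : power_basis g M qg) (vh : power_basis h N qh) :
  monoidal_isomorphic
    (mcomp (simple_current Dg vg) (simple_current Dh vh))
    (mcomp (simple_current Dh vh) (simple_current Dg vg)).
Proof.
have hhg := monodromy_sym hgh.
exists (exchange Dg Dh vg vh); split=> [X|X Y f|X Y].
- exists (exchange Dh Dg vh vg X); split; apply: of_bisummand_epi => m n.
    rewrite -compA exchange_of_summand // compA exchange_of_summand // -compA.
    by rewrite swapK ?comp_idr ?comp_idl //; apply: monodromy_tpow_tpow.
  rewrite -compA exchange_of_summand // compA exchange_of_summand // -compA.
  by rewrite swapK ?comp_idr ?comp_idl //; apply: monodromy_tpow_tpow.
- exact: exchange_nat.
- exact: exchange_monoidal.
Qed.
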